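(* Let $G$ be an abelian group and $S\subset\mathcal P_G$. If $\mathbb F$ is an algebraically closed field, then $\mathrm H^2_S(\mathbb F^\times)\simeq\mathrm{Hom}(\mathcal K_S,\mathbb F^\times)$.
   Context: $G$ is written multiplicatively. $\mathcal P_G$ is the set of unordered pairs $\{g,h\}$ of elements of $G$ (with $g=h$ allowed). $\mathcal F_G$ is the free abelian group (written multiplicatively) on $\mathcal P_G$, and $\mathcal R_G\subset\mathcal F_G$ is the set of all elements $\{g,h\}\{gh,k\}\{h,k\}^{-1}\{g,hk\}^{-1}$ with $g,h,k\in G$. For $S\subset\mathcal P_G$, $\mathcal F_S\subset\mathcal F_G$ is the free abelian group on $S$, $\mathcal R_S:=\mathcal R_G\cap\mathcal F_S$, $\mathcal Z_S:=\mathcal F_S/\langle\mathcal R_S\rangle$, and $\mathcal K_S:=(\langle\mathcal R_G\rangle\cap\mathcal F_S)/\langle\mathcal R_S\rangle$, i.e. the kernel of the homomorphism $\mathcal Z_S\to\mathcal F_G/\langle\mathcal R_G\rangle$ induced by inclusion. $\mathrm B^2_S(\mathbb F^\times)$ is the group of restrictions to $S$ of the functions $d\alpha(g,h)=\alpha(g)\alpha(h)\alpha(gh)^{-1}$, for arbitrary maps $\alpha\colon G\to\mathbb F^\times$, viewed as a subgroup of $\mathrm{Fun}(S,\mathbb F^\times)=\mathrm{Hom}(\mathcal F_S,\mathbb F^\times)$; it lies in $\mathrm{Hom}(\mathcal Z_S,\mathbb F^\times)$. $\mathrm H^2_S(\mathbb F^\times):=\mathrm{Hom}(\mathcal Z_S,\mathbb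 F^\times)/\mathrm B^2_S(\mathbb F^\times)$. *)

(* Defs.v *)
From HB Require Import structures.
From mathcomp Require Import all_boot all_order all_algebra.
From mathcomp Require Import boolp classical_sets functions.
From mathcomp Require Import freeg.

Set Implicit Arguments.
Unset Strict Implicit.
Unset Printing Implicit Defensive.

Import GRing.Theory.

Local Open Scope classical_set_scope.
Local Open Scope ring_scope.
Local Open Scope quotient_scope.

(* All abelian groups are zmodTypes, hence in additive notation, including G
   and the multiplicative group of a field. *)

Section Subgroup.
Variables (V : zmodType) (A : zmodClosed V).

Record subgroup_type := Subgroup {
  subgroup_val :> V;
  subgroup_valP : subgroup_val \in A }.

HB.instance Definition _ := [isSub for subgroup_val].
HB.instance Definition _ := [Choice of subgroup_type by <:].
HB.instance Definition _ := [SubChoice_isSubZmodule of subgroup_type by <:].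
End Subgroup.

Section SubgroupPreimage.
Variables (U V : zmodType) (f : {additive U -> V}) (B : zmodClosed V).

Definition preimage_pred : {pred U} := fun x => f x \in B.

Lemma mem_preimage_pred x : (x \in preimage_pred) = (f x \in B).
Proof. by []. Qed.

Fact preimage_zmod_closed : zmod_closed preimage_pred.
Proof.
split=> [|x y]; rewrite !mem_preimage_pred ?raddf0 ?rpred0 // => fx fy.
by rewrite raddfB rpredB.
Qed.
HB.instance Definition _ :=
  GRing.isZmodClosed.Build U preimage_pred preimage_zmod_closed.
End SubgroupPreimage.

Section Subquotient.
Variables (V : zmodType) (A B : zmodClosed V).

(* Used below only when B is contained in A; in general this is A/(A :&: B). *)
Definition subquotient : zmodType :=
  {ideal_quot (preimage_pred (val : subgroup_type A -> V) B)}.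

Definition subquotient_class (x : subgroup_type A) : subquotient :=
  \pi_({ideal_quot (preimage_pred (val : subgroup_type A -> V) B)}) x.

Fact subquotient_class_zmod_morphism : zmod_morphism subquotient_class.
Proof. by move=> x y; rewrite /subquotient_class raddfB. Qed.
HB.instance Definition _ := GRing.isZmodMorphism.Build (subgroup_type A)
  subquotient subquotient_class subquotient_class_zmod_morphism.

Lemma subquotient_class_surj (z : subquotient) :
  exists x, z = subquotient_class x.
Proof. by exists (repr z); rewrite /subquotient_class reprK. Qed.

Lemma subquotient_class_eq0 x : (subquotient_class x == 0) = (val x \in B).
Proof.
rewrite -(raddf0 subquotient_class) /subquotient_class.
have := Quotient.idealrBE (preimage_pred (val : subgroup_type A -> V) B) x 0.
by rewrite subr0 mem_preimage_pred => ->; rewrite piE.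
Qed.
End Subquotient.

Section Intersection.
Variables (V : zmodType) (A B : zmodClosed V).

Definition capz : {pred V} := fun x => (x \in A) && (x \in B).

Lemma mem_capz x : (x \in capz) = (x \in A) && (x \in B).
Proof. by []. Qed.

Fact capz_zmod_closed : zmod_closed capz.
Proof.
split=> [|x y]; rewrite !mem_capz ?rpred0 //.
by move=> /andP[xA xB] /andP[yA yB]; rewrite !rpredB.
Qed.
HB.instance Definition _ := GRing.isZmodClosed.Build V capz capz_zmod_closed.
End Intersection.

Section Generated.
Variables (V : zmodType) (X : set V).

Definition generated : {pred V} :=
  fun x => `[< smallest (fun H : set V => zmod_closed (mem H)) X x >].

Fact generated_zmod_closed : zmod_closed generated.
Proof.
split=> [|x y]; rewrite !unfold_in.
  by apply/asboolP => H [[H0 _] _]; exact: set_mem.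
move=> /asboolP gx /asboolP gy; apply/asboolP => H HP.
case: (HP) => -[_ HB] _; apply/set_mem/HB; apply/mem_set.
  exact: gx.
exact: gy.
Qed.
HB.instance Definition _ :=
  GRing.isZmodClosed.Build V generated generated_zmod_closed.
End Generated.

Section AddHom.
Variables A B : zmodType.

Definition additive_pred : {pred A -> B} := fun f => `[< zmod_morphism f >].

Fact additive_zmod_closed : zmod_closed additive_pred.
Proof.
split=> [|f g]; rewrite !unfold_in.
  by apply/asboolP => x y; rewrite subr0.
move=> /asboolP hf /asboolP hg; apply/asboolP => x y.
by rewrite /= !fctE hf hg !opprD opprK addrACA.
Qed.
HB.instance Definition _ :=
  GRing.isZmodClosed.Build (A -> B) additive_pred additive_zmod_closed.

Definition AddHom : zmodType := subgroup_type additive_pred.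
End AddHom.

Section UnitGroup.
Variable F : fieldType.

Record units_type := Units {
  units_val :> F;
  units_valP : units_val != 0 }.

HB.instance Definition _ := [isSub for units_val].
HB.instance Definition _ := [Choice of units_type by <:].

Definition units_one := Units (oner_neq0 F).
Definition units_inv (x : units_type) : units_type :=
  Units (invr_neq0 (units_valP x)).
Definition units_mul (x y : units_type) : units_type :=
  Units (mulf_neq0 (units_valP x) (units_valP y)).

Fact units_mulA : associative units_mul.
Proof. by move=> x y z; apply/val_inj; rewrite /= mulrA. Qed.
Fact units_mulC : commutative units_mul.
Proof. by move=> x y; apply/val_inj; rewrite /= mulrC. Qed.
Fact units_mul1 : left_id units_one units_mul.
Proof. by move=> x; apply/val_inj; rewrite /= mul1r. Qed.
Fact units_mulV : left_inverse units_one units_inv units_mul.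
Proof. by move=> x; apply/val_inj; rewrite /= mulVf ?units_valP. Qed.

(* The zero, opposite and sum of this zmodType are the one, inverse and
   product of F. *)
HB.instance Definition _ :=
  GRing.isZmodule.Build units_type units_mulA units_mulC units_mul1 units_mulV.
End UnitGroup.

Section UnorderedPairs.
Variable G : choiceType.

Definition swap_eq (p q : G * G) : bool := (p == q) || (p == (q.2, q.1)).

Fact swap_eq_refl : reflexive swap_eq.
Proof. by move=> p; rewrite /swap_eq eqxx. Qed.
Fact swap_eq_sym : symmetric swap_eq.
Proof.
move=> [a b] [c d]; rewrite /swap_eq !xpair_eqE /= [c == _]eq_sym [d == b]eq_sym.
by rewrite [c == b]eq_sym [d == a]eq_sym [(b == c) && _]andbC.
Qed.
Fact swap_eq_trans : transitive swap_eq.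
Proof.
move=> [a b] [c d] [e f]; rewrite /swap_eq.
by move=> /orP[]/eqP[-> ->] /orP[]/eqP[-> ->]; rewrite eqxx ?orbT.
Qed.

Definition swap_equiv := EquivRel swap_eq swap_eq_refl swap_eq_sym swap_eq_trans.

Definition upair := {eq_quot swap_equiv}.
HB.instance Definition _ := Choice.on upair.

Definition mkupair (g h : G) : upair := \pi_({eq_quot swap_equiv}) (g, h).
End UnorderedPairs.

Section PartialCohomology.
Variable G : zmodType.
Local Notation FG := {freeg (upair G) / int}.

Definition relator (g h k : G) : FG :=
  << mkupair g h >> + << mkupair (g + h) k >>
  - << mkupair h k >> - << mkupair g (h + k) >>.

Definition RG : set FG := [set D | exists g h k, D = relator g h k].

Variable S : set (upair G).

(* F_S is realised inside F_G as the formal sums supported in S. *)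
Definition FS : {pred FG} := fun D => all (fun p => p \in S) (dom D).

Fact FS_zmod_closed : zmod_closed FS.
Proof.
split=> [|D E]; rewrite !unfold_in ?dom0 // => /allP SD /allP SE.
apply/allP => p /domD_subset; rewrite mem_cat domN.
by move=> /orP[/SD|/SE].
Qed.
HB.instance Definition _ := GRing.isZmodClosed.Build FG FS FS_zmod_closed.

Definition RS : set FG := RG `&` [set D | D \in FS].

Definition ZS : zmodType := subquotient FS (generated RS).

Definition KS : zmodType := subquotient (capz (generated RG) FS) (generated RS).

Fact gen_in_FS (p : S) : << val p >> \in FS.
Proof. by rewrite unfold_in domU1 /= andbT; exact: valP. Qed.

Variable F : fieldType.
Local Notation Fx := (units_type F).

(* Independent of the ordering chosen by repr: see coboundE. *)
Definition cobound (alpha : G -> Fx) (p : upair G) : Fx :=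
  alpha (repr p).1 + alpha (repr p).2 - alpha ((repr p).1 + (repr p).2).

Lemma coboundE alpha g h :
  cobound alpha (mkupair g h) = alpha g + alpha h - alpha (g + h).
Proof.
rewrite /cobound /mkupair; case: piP => -[a b] /eqmodP /orP[]/eqP[-> ->] //=.
by rewrite [b + a]addrC [alpha b + _]addrC.
Qed.

Definition B2_pred : {pred (S -> Fx)} :=
  fun f => `[< exists alpha, f = fun p : S => cobound alpha (val p) >].

Fact B2_zmod_closed : zmod_closed B2_pred.
Proof.
split=> [|f g]; rewrite !unfold_in.
  apply/asboolP; exists (fun=> 0); apply/funext => p.
  by rewrite /cobound addr0 subr0.
move=> /asboolP[a ->] /asboolP[b ->]; apply/asboolP.
exists (a - b); apply/funext => p /=.
have subA (V : zmodType) (x x' y y' z z' : V) :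
    (x + y - z) - (x' + y' - z') = (x - x') + (y - y') - (z - z').
  rewrite [(x - x') + _]addrACA -opprD !opprB [z' - (_ + _)]addrC.
  by rewrite addrACA [- z + z']addrC.
exact: subA.
Qed.
HB.instance Definition _ :=
  GRing.isZmodClosed.Build (S -> Fx) B2_pred B2_zmod_closed.

(* The embedding of Hom(Z_S, F^x) into Fun(S, F^x) = Hom(F_S, F^x). *)
Definition Hom_Fun (chi : AddHom ZS Fx) : S -> Fx :=
  fun p => val chi (subquotient_class _ (Subgroup (gen_in_FS p))).

Fact Hom_Fun_additive : zmod_morphism Hom_Fun.
Proof. by []. Qed.
HB.instance Definition _ :=
  GRing.isZmodMorphism.Build (AddHom ZS Fx) (S -> Fx) Hom_Fun Hom_Fun_additive.

Lemma B2_sub_Hom (f : S -> Fx) :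
  f \in B2_pred -> exists chi : AddHom ZS Fx, Hom_Fun chi = f.
Proof.
move=> /asboolP[alpha ->].
pose L : FG -> zmodule Fx := fglift (cobound alpha : upair G -> zmodule Fx).
have LB : zmod_morphism L := lift_is_additive (cobound alpha : _ -> zmodule Fx).
pose aL : GRing.isZmodMorphism FG (zmodule Fx) L :=
  GRing.isZmodMorphism.Build _ _ L LB.
pose LL : {additive FG -> zmodule Fx} := HB.pack L aL.
have LU p : LL << p >> = cobound alpha p :> zmodule Fx.
  by rewrite /= /L liftU scale1r.
have LR x : x \in generated RS -> LL x = 0.
  move=> /asboolP /(_ [set x | LL x = 0]); apply; split.
    split; first by apply/mem_set; rewrite /= -[L 0]/(LL 0) raddf0.
    move=> u v /set_mem/= Lu /set_mem/= Lv; apply/mem_set.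
    by rewrite /= -[L _]/(LL _) raddfB /= Lu Lv subrr.
  move=> _ [[g [h [k ->]]] _] /=.
  rewrite -[L _]/(LL _) !raddfB raddfD !LU !coboundE.
  set a := alpha g; set b := alpha h; set c := alpha k.
  set d := alpha (g + h); set e := alpha (h + k).
  rewrite -[(g + h + k)]addrA; set m := alpha (g + (h + k)).
  clearbody a b c d e m; rewrite -addrA -opprD.
  have tele (V : zmodType) (p q r t : V) : (p - q) + (q + r - t) = p + r - t.
    by rewrite -(addrA q) (addrA (p - q)) subrK addrA.
  have tele2 (V : zmodType) (p q r t u m' : V) :
    (p + q - t) + (t + r - m') - ((q + r - u) + (p + u - m')) = 0.
    by rewrite tele [p + u]addrC tele [q + r + p]addrC addrA subrr.
  exact: (tele2 Fx a b c d e m).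
pose chi (z : ZS) : Fx := LL (val (repr z)).
have chiE x : chi (subquotient_class _ x) = LL (val x).
  rewrite /chi /subquotient_class; case: piP => y /eqmodP.
  rewrite /= /Quotient.equiv mem_preimage_pred => /LR.
  by rewrite !raddfB => /subr0_eq.
have chiP : chi \in @additive_pred ZS Fx.
  apply/asboolP => u v.
  have [[x ->] [y ->]] := (subquotient_class_surj u, subquotient_class_surj v).
  by rewrite -raddfB !chiE !raddfB.
exists (Subgroup chiP); apply/funext => p.
by rewrite /Hom_Fun /= chiE; exact: LU.
Qed.

(* Hom_Fun is injective, as Z_S is generated by the classes of the elements of
   S, and by B2_sub_Hom its image contains B^2; so the preimage of B^2 below is
   B^2 seen as a subgroup of Hom(Z_S, F^x). *)
Definition H2 : zmodType := {ideal_quot (preimage_pred Hom_Fun B2_pred)}.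
End PartialCohomology.

(* Main.v *)
Require Import Defs.
From HB Require Import structures.
From mathcomp Require Import all_boot all_algebra boolp classical_sets.
From mathcomp Require Import freeg.

(* The isomorphism is induced by restricting characters of Z_S to K_S. Since F is
   algebraically closed, F^x is divisible, hence injective, and the restriction is
   surjective. A character of Z_S in its kernel vanishes on <R_G> :&: F_S, so it
   extends to a character of F_G trivial on R_G, i.e. to a symmetric 2-cocycle on
   G; as Ext(G, F^x) = 0, this cocycle is a coboundary. *)

Set Implicit Arguments.
Unset Strict Implicit.
Unset Printing Implicit Defensive.

Import GRing.Theory Num.Theory.

Local Open Scope classical_set_scope.
Local Open Scope ring_scope.
Local Open Scope quotient_scope.

(** * Divisible groups and subgroups *)

Definition divisible (D : zmodType) :=
  forall n (x : D), (0 < n)%N -> exists y, y *+ n = x.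

(** Stated for sets, so that graphs given by existential conditions and unions of chains qualify
    directly. *)
Definition is_subgroup (V : zmodType) (A : set V) :=
  A 0 /\ forall x y, A x -> A y -> A (x - y).

Section IsSubgroup.
Variables (V : zmodType) (A : set V) (sA : is_subgroup A).

Lemma subgroup0 : A 0. Proof. by case: sA. Qed.

Lemma subgroupB x y : A x -> A y -> A (x - y). Proof. by case: sA => _; apply. Qed.

Lemma subgroupN x : A x -> A (- x).
Proof. by move=> Ax; rewrite -sub0r; exact: subgroupB subgroup0 Ax. Qed.

Lemma subgroupD x y : A x -> A y -> A (x + y).
Proof. by move=> Ax /subgroupN; rewrite -{2}[y]opprK; exact: subgroupB. Qed.

Lemma subgroupMz x (k : int) : A x -> A (x *~ k).
Proof.
move=> Ax; have AMn n : A (x *+ n).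
  by elim: n => [|n An]; [exact: subgroup0 | rewrite mulrS; exact: subgroupD].
by case: k => n; [exact: AMn | rewrite NegzE mulrNz; exact/subgroupN/AMn].
Qed.
End IsSubgroup.

(** * Extension of homomorphisms into divisible groups *)

Section DivisibleExtension.
Variables V D : zmodType.
Implicit Types Gam Del : set (V * D).

(** The graph of a homomorphism from a subgroup of [V] to [D]; for a subgroup, single-valuedness
    need only be tested over 0. *)
Definition partial_hom Gam :=
  is_subgroup Gam /\ forall d, Gam (0, d) -> d = 0.

Lemma partial_hom_fun Gam x d d' :
  partial_hom Gam -> Gam (x, d) -> Gam (x, d') -> d = d'.
Proof.
case=> sG G0 Gd Gd'; apply/subr0_eq/G0; rewrite -[0](subrr x).
exact: (subgroupB sG Gd Gd').
Qed.

(* If no positive multiple of v is in the domain, d is arbitrary; otherwise,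
   for n the least such, the domain contains the multiple kv only if n | k. *)
Lemma partial_hom_value Gam v : divisible D -> partial_hom Gam ->
  exists d, forall (k : int) e, Gam (v *~ k, e) -> e = d *~ k.
Proof.
move=> divD GP; have [sG G0] := GP.
pose P n := `[< (0 < n)%N /\ exists e, Gam (v *+ n, e) >].
have [[m Pm]|nP] := pselect (exists n, P n); last first.
  exists 0 => k e; rewrite mul0rz; case: k => [[|n]|n] Ge.
  - exact: G0.
  - by case: nP; exists n.+1; apply/asboolP; split=> //; exists e.
  case: nP; exists n.+1; apply/asboolP; split=> //; exists (- e).
  by have := subgroupN sG Ge; rewrite NegzE mulrNz /= -[- (_, _)]/(- _, - _) opprK.
have [n /asboolP[n0 [e Gne]] nmin] := ex_minnP (ex_intro _ m Pm).
have [d de] := divD n e n0; exists d => k e' Gk.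
have kE := divz_eq k n.
set q := (k %/ n)%Z in kE; set r := (k %% n)%Z in kE.
have r0 : 0 <= r by rewrite modz_ge0 // eqz_nat -lt0n.
have rn : r < n by rewrite ltz_pmod // ltz_nat.
(* Subtracting [q] times [(v *+ n, e)] leaves a multiple [r < n] of [v] in the domain, so minimality
   of [n] forces [r = 0]. *)
have Gr : Gam (v *~ r, e' - e *~ q).
  have := subgroupB sG Gk (subgroupMz sG q Gne).
  suff -> : (v *~ k, e') - (v *+ n, e) *~ q = (v *~ r, e' - e *~ q) by [].
  have pairMz (x : V) (y : D) (i : int) : (x, y) *~ i = (x *~ i, y *~ i).
    have pairMn j : (x, y) *+ j = (x *+ j, y *+ j).
      by elim: j => [|j IH]; rewrite ?mulr0n // !mulrS IH.
    by case: i => j; rewrite ?NegzE ?mulrNz -!pmulrn pairMn.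
  rewrite pairMz -[LHS]/(v *~ k - _, e' - _); congr (_, _).
  by rewrite {1}kE mulrzDr mulrC mulrzA -pmulrn addrAC subrr add0r.
case: r r0 rn kE Gr => // -[|r] _ rn kE Gr.
  by rewrite kE addr0 mulrC mulrzA -pmulrn de; exact/subr0_eq/G0.
suff /nmin : P r.+1 by rewrite leqNgt -ltz_nat rn.
by apply/asboolP; split=> //; exists (e' - e *~ q).
Qed.

(** Adjoin the multiples of [(v, d)], with [d] from [partial_hom_value]. A point [(0, y)] of the sum
    puts [(- v *~ k, y - d *~ k)] in [Gam], and the choice of [d] gives [y = 0]. *)
Lemma partial_hom_extend Gam v : divisible D -> partial_hom Gam ->
  exists Del, [/\ partial_hom Del, Gam `<=` Del & exists d, Del (v, d)].
Proof.
move=> divD GP; have [sG G0] := GP.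
have [d dP] := partial_hom_value v divD GP.
exists [set p | exists k : int, Gam (p.1 - v *~ k, p.2 - d *~ k)].
split; first split; first split.
- by exists 0; rewrite !subr0; exact: subgroup0 sG.
- move=> [x y] [x' y'] [k Gk] [k' Gk']; exists (k - k') => /=.
  have := subgroupB sG Gk Gk'; rewrite /= !mulrzBr.
  rewrite -[(_, _) - (_, _)]/(_ - _, _ - _).
  by congr (Gam (_, _)); rewrite !opprD !opprK addrACA.
- move=> y [k]; rewrite /= sub0r -mulrNz => /dP /eqP.
  by rewrite mulrNz subr_eq addrC subrr => /eqP.
- by move=> [x y] Gxy; exists 0; rewrite !subr0.
by exists d, 1; rewrite !subrr; exact: subgroup0 sG.
Qed.

(** Injectivity of divisible groups: Zorn's lemma gives a maximal graph above [Gam], whose domain is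
    all of [V] by [partial_hom_extend]. *)
Lemma partial_hom_total Gam : divisible D -> partial_hom Gam ->
  exists g : {additive V -> D}, forall x d, Gam (x, d) -> d = g x.
Proof.
move=> divD GP.
(* The empty set is admitted to accommodate the union of the empty chain. *)
pose P Del := Del = set0 \/ partial_hom Del /\ Gam `<=` Del.
have [Del [PDel maxDel]] : exists Del, P Del /\ forall B, Del `<` B -> ~ P B.
  apply: Zorn_bigcup => C CP Ctot.
  have [[B CB nB]|C0] := pselect (exists2 B, C B & B !=set0); last first.
    left; apply/seteqP; split=> // p [B CB Bp].
    by apply: C0; exists B => //; exists p.
  have CPhom B' p : C B' -> B' p -> partial_hom B' /\ Gam `<=` B'.
    by move=> /CP[->|].
  have [p Bp] := nB; have [[sB B0] GB] := CPhom _ _ CB Bp.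
  right; split; last by move=> q /GB Bq; exists B.
  split; last by move=> e [B' CB' B'e]; have [[_ +] _] := CPhom _ _ CB' B'e; apply.
  split; first by exists B => //; exact: subgroup0 sB.
  move=> x y [B1 CB1 B1x] [B2 CB2 B2y].
  have [[s1 _] _] := CPhom _ _ CB1 B1x; have [[s2 _] _] := CPhom _ _ CB2 B2y.
  have [/(_ x B1x) B2x|/(_ y B2y) B1y] := Ctot _ _ CB1 CB2.
    by exists B2 => //; exact: (subgroupB s2).
  by exists B1 => //; exact: (subgroupB s1).
have {PDel} [DP GD] : partial_hom Del /\ Gam `<=` Del.
  (* The empty set is not maximal, since [Gam] is admissible and contains 0. *)
  case: PDel => // D0; exfalso; apply: (maxDel Gam); last by right; split.
  rewrite D0; split; first exact: sub0set.
  by move=> /(_ _ (subgroup0 GP.1)).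
have Dtot v : exists d, Del (v, d).
  have [B [BP DB [d Bd]]] := partial_hom_extend v divD DP.
  have [BD|nBD] := pselect (B `<=` Del); first by exists d; exact: BD.
  exfalso; apply: (maxDel B); first by split.
  by right; split=> //; exact: subset_trans DB.
have [g gP] := choice Dtot.
have gB : zmod_morphism g.
  move=> x y; apply: (partial_hom_fun DP (gP _)).
  exact: (subgroupB DP.1 (gP x) (gP y)).
pose gA : {additive V -> D} := HB.pack g (GRing.isZmodMorphism.Build V D g gB).
by exists gA => x d /GD Dx; exact: partial_hom_fun DP Dx (gP x).
Qed.
End DivisibleExtension.

(** * Symmetric cocycles with divisible coefficients *)

(* On D * G itself, HB.pack would pick up the componentwise group structure. *)
Definition twisted_prod (D G : zmodType) : Type := D * G.
HB.instance Definition _ (D G : zmodType) := Choice.on (twisted_prod D G).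

(* r is a retraction onto D of the extension of G by D with factor set c, whose
   zero is (- c 0 0, 0). *)
Lemma symmetric_cocycle_coboundary (G D : zmodType) (c : G -> G -> D) :
    divisible D -> (forall g h, c g h = c h g) ->
    (forall g h k, c g h + c (g + h) k = c h k + c g (h + k)) ->
  exists alpha, forall g h, c g h = alpha g + alpha h - alpha (g + h).
Proof.
move=> divD cC cA.
(* The cocycle is not assumed normalised, which is why [c 0 0] enters the zero, the opposite and the
   embedding of [D]. *)
have c0 g : c 0 g = c 0 0.
  by apply/(@addIr _ (c 0 g)); have := cA 0 0 g; rewrite !add0r.
pose add (x y : D * G) := (x.1 + y.1 + c x.2 y.2, x.2 + y.2).
pose opp (x : D * G) := (- x.1 - c (- x.2) x.2 - c 0 0, - x.2).
have addA : associative add.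
  move=> [a g] [b h] [d k]; rewrite /add /=; congr (_, _); last exact: addrA.
  rewrite (AC (1*3*1) ((1*2*3)*(4*5))) /= -cA.
  by rewrite [RHS](ACl ((1*2*4)*(3*5))).
have addC : commutative add.
  by move=> [a g] [b h]; rewrite /add /= cC [a + b]addrC [g + h]addrC.
have add0 : left_id (- c 0 0, 0) add.
  by move=> [a g]; rewrite /add /= c0 add0r addrAC addNr add0r.
have addN : left_inverse (- c 0 0, 0) opp add.
  move=> [a g]; rewrite /add /opp /= addNr; congr (_, _).
  by rewrite (ACl ((1*4)*(2*5)*3)) /= !addNr !add0r.
pose E : zmodType :=
  HB.pack (twisted_prod D G)
    (GRing.isZmodule.Build (twisted_prod D G) addA addC add0 addN).
(* The inverse of the embedding of [D] into [E] by [d |-> (d - c 0 0, 0)]; a total extension of it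
   is a retraction. *)
pose Gam : set (E * D) := [set p | p.1 = (p.2 - c 0 0, 0)].
have addE (x y : E) : x + y = add x y by [].
have oppE (x : E) : - x = opp x by [].
have [|r rP] := @partial_hom_total E D Gam divD.
  split; last first.
    by move=> d; rewrite /Gam /= => -[e]; rewrite -[d](subrK (c 0 0)) -e addNr.
  split; first by rewrite /Gam /= sub0r.
  move=> [x a] [y b]; rewrite /Gam /= => -> ->.
  rewrite addE oppE /add /opp /= oppr0 addr0; congr (_, _).
  by rewrite opprB !addrA !addrNK addrAC.
(* In [E], [(0, g) + (0, h)] is the image of [c g h] plus [(0, g + h)]; apply [r]. *)
exists (fun g => r (0, g)) => g h.
rewrite -raddfD addE /add /= add0r add0r.
have -> : (c g h, g + h) = ((c g h - c 0 0, 0) : E) + (0, g + h).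
  by rewrite addE /add /= c0 addr0 addrNK add0r.
by rewrite raddfD addrK; exact: rP.
Qed.

(** * Quotients, free abelian groups and characters of subquotients *)

Lemma ideal_quot_lift (U W : zmodType) (B : zmodClosed U) (h : {additive U -> W}) :
    (forall x, x \in B -> h x = 0) ->
  exists h' : {additive {ideal_quot B} -> W},
    forall x, h' (\pi_({ideal_quot B}) x) = h x.
Proof.
move=> hB; pose h' (z : {ideal_quot B}) := h (repr z).
have h'E x : h' (\pi x) = h x.
  rewrite /h'; case: piP => y /eqmodP; rewrite /= /Quotient.equiv => /hB.
  by rewrite raddfB => /subr0_eq.
have h'B : zmod_morphism h'.
  move=> x y; rewrite -[x]reprK -[y]reprK.
  by rewrite -raddfB !h'E raddfB.
pose h'A : {additive {ideal_quot B} -> W} :=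
  HB.pack h' (GRing.isZmodMorphism.Build _ _ h' h'B).
by exists h'A.
Qed.

(** First isomorphism theorem; the inverse map chooses preimages under [h]. *)
Lemma ideal_quot_iso (U W : zmodType) (B : zmodClosed U) (h : {additive U -> W}) :
    (forall x, (x \in B) = (h x == 0)) -> (forall w, exists x, h x = w) ->
  exists f : {additive {ideal_quot B} -> W}, bijective f.
Proof.
move=> hB hsurj.
have [|f fE] := @ideal_quot_lift U W B h; first by move=> x; rewrite hB => /eqP.
exists f; have [s sP] := choice hsurj.
exists (fun w => \pi_({ideal_quot B}) (s w)) => [z|w]; last by rewrite fE.
rewrite -[z]reprK fE; apply/eqP; rewrite -Quotient.idealrBE hB.
by rewrite raddfB sP subrr.
Qed.

Lemma freeg_lift (T : choiceType) (D : zmodType) (c : T -> D) :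
  exists L : {additive {freeg T / int} -> D}, forall p, L << p >> = c p.
Proof.
pose L : {freeg T / int} -> D := fglift (c : T -> zmodule D).
have LB : zmod_morphism L := lift_is_additive (c : T -> zmodule D).
pose LA : {additive {freeg T / int} -> D} :=
  HB.pack L (GRing.isZmodMorphism.Build _ _ L LB).
by exists LA => p; rewrite /= /L liftU scale1r.
Qed.

Section SubquotientCharacters.
Variables (V D : zmodType) (A B : zmodClosed V).

Lemma AddHom_additive (U W : zmodType) (chi : AddHom U W) :
  zmod_morphism (val chi).
Proof. exact/asboolP/(valP chi). Qed.

Lemma subquotient_restrict (g : {additive V -> D}) :
    (forall x, x \in B -> g x = 0) ->
  exists chi : AddHom (subquotient A B) D,
    forall x, val chi (subquotient_class B x) = g (val x).
Proof.
move=> gB.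
have [|h hE] := @ideal_quot_lift _ _ (preimage_pred (val : subgroup_type A -> V) B)
    (g \o val).
  by move=> x; exact: gB.
have hP : (h : _ -> D) \in @additive_pred (subquotient A B) D.
  by apply/asboolP => x y; rewrite raddfB.
by exists (Subgroup hP) => x; rewrite /= /subquotient_class hE.
Qed.

(** Pulled back to [A], [chi] is a homomorphism on a subgroup of [V], which divisibility extends.
    Characters of [ZS] and of [KS] thus both come from characters of F_G. *)
Lemma subquotient_extend (chi : AddHom (subquotient A B) D) : divisible D ->
  exists g : {additive V -> D},
    forall x, val chi (subquotient_class B x) = g (val x).
Proof.
move=> divD; have chiB := AddHom_additive chi.
pose Gam : set (V * D) :=
  [set p | exists2 x, p.1 = val x & p.2 = val chi (subquotient_class B x)].
have chi0 : val chi 0 = 0 by rewrite -[X in val chi X](subrr 0) chiB subrr.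
have [|g gP] := @partial_hom_total V D Gam divD.
  split; first split.
  - by exists 0; rewrite ?raddf0.
  - move=> [_ _] [_ _] [x /= -> ->] [y /= -> ->].
    by exists (x - y); rewrite ?raddfB ?chiB.
  move=> d [x /= x0 ->]; have -> : x = 0 by apply: val_inj; rewrite raddf0.
  by rewrite raddf0.
by exists g => x; apply: gP; exists x.
Qed.
End SubquotientCharacters.

(** * Roots in the unit group of an algebraically closed field *)

Lemma closed_units_divisible (F : closedFieldType) : divisible (units_type F).
Proof.
move=> n x n0.
(* These are the lower coefficients in [y ^+ n = x]: only the constant one is non-zero. *)
have [y yn] := solve_monicpoly (fun i => if i == 0%N then val x else 0) n0.
have {}yn : y ^+ n = val x.
  case: n n0 yn => // n _ ->; rewrite big_ord_recl expr0 mulr1 big1 ?addr0 // => i _.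
  by rewrite mul0r.
have y0 : y != 0.
  apply: contraNneq (units_valP x) => y0.
  by rewrite -[units_val x]yn y0 expr0n gtn_eqF.
exists (Units y0); apply: val_inj; rewrite -yn; elim: (n) => [|m IH].
  by rewrite mulr0n.
by rewrite mulrS exprS -IH.
Qed.

(** * Maps and induction on generated subgroups *)

Section Generated.
Variables (V : zmodType) (X : set V).

Lemma mem_generated x : X x -> x \in generated X.
Proof. by move=> Xx; apply/asboolP => H [_ XH]; exact: XH. Qed.

Lemma generated_ind (H : set V) x :
  is_subgroup H -> X `<=` H -> x \in generated X -> H x.
Proof.
move=> [H0 HB] XH /asboolP; apply; split=> //; split; first exact/mem_set.
by move=> u v /set_mem Hu /set_mem Hv; apply/mem_set/HB.
Qed.

Lemma additive_generated0 (W : zmodType) (h : {additive V -> W}) x :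
  (forall y, X y -> h y = 0) -> x \in generated X -> h x = 0.
Proof.
move=> hX; apply: (@generated_ind [set y | h y = 0]) => //; split=> /=.
  exact: raddf0.
by move=> u v hu hv; rewrite raddfB hu hv subrr.
Qed.
End Generated.

(** * Restriction of characters from [ZS] to [KS] *)

Section Restriction.
Variables (G : zmodType) (S : set (upair G)) (F : closedFieldType).
Local Notation FG := {freeg (upair G) / int}.
Local Notation Fx := (units_type F).
Local Notation FS := (@FS G S).
Local Notation genRG := (generated (@RG G)).
Local Notation genRS := (generated (RS S)).
Local Notation clsZ := (@subquotient_class _ FS genRS).
Local Notation clsK := (@subquotient_class _ (capz genRG FS) genRS).

Lemma upair_mk (p : upair G) : p = mkupair (repr p).1 (repr p).2.
Proof. by rewrite /mkupair -surjective_pairing reprK. Qed.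

Lemma genRS_sub x : x \in genRS -> x \in capz genRG FS.
Proof.
apply: (@generated_ind _ _ [set y | y \in capz genRG FS]).
  by split=> [|u v]; [exact: rpred0 | exact: rpredB].
by move=> y [RGy FSy] /=; rewrite mem_capz mem_generated.
Qed.

Lemma capz_FS (x : subgroup_type (capz genRG FS)) : val x \in FS.
Proof. by have := valP x; rewrite mem_capz => /andP[]. Qed.

Lemma KS_to_ZS :
  exists i : {additive KS S -> ZS S},
    forall x, i (clsK x) = clsZ (Subgroup (capz_FS x)).
Proof.
pose j x := clsZ (Subgroup (capz_FS x)).
have jB : zmod_morphism j.
  move=> x y; rewrite /j -raddfB; congr (clsZ _); exact: val_inj.
pose jA : {additive subgroup_type (capz genRG FS) -> ZS S} :=
  HB.pack j (GRing.isZmodMorphism.Build _ _ j jB).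
have [|i iE] := @ideal_quot_lift _ _
    (preimage_pred (val : subgroup_type (capz genRG FS) -> FG) genRS) jA.
  by move=> x xB; apply/eqP; rewrite subquotient_class_eq0.
by exists i => x; exact: iE.
Qed.

Lemma res_KS : exists r : {additive AddHom (ZS S) Fx -> AddHom (KS S) Fx},
  forall chi x, val (r chi) (clsK x) = val chi (clsZ (Subgroup (capz_FS x))).
Proof.
have [i iE] := KS_to_ZS.
have rP (chi : AddHom (ZS S) Fx) :
    (fun z => val chi (i z)) \in @additive_pred (KS S) Fx.
  by apply/asboolP => x y; rewrite raddfB AddHom_additive.
pose r chi : AddHom (KS S) Fx := Subgroup (rP chi).
have rB : zmod_morphism r by move=> chi psi; exact: val_inj.
pose rA : {additive AddHom (ZS S) Fx -> AddHom (KS S) Fx} :=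
  HB.pack r (GRing.isZmodMorphism.Build _ _ r rB).
by exists rA => chi x; rewrite /= iE.
Qed.

Lemma freeg_eq_on_FS (g h : {additive FG -> Fx}) x :
  (forall p : S, g << val p >> = h << val p >>) -> x \in FS -> g x = h x.
Proof.
move=> gh /allP xS; rewrite -[x]freeg_sumE !raddf_sum big_seq [RHS]big_seq.
apply: eq_bigr => p /xS pS.
have -> : << coeff p x *g p >> = << p >> *~ coeff p x :> FG.
  by rewrite freegU_mulz intz.
by rewrite !raddfMz (gh (SigSub pS)).
Qed.

(** This computes the kernel of restriction. As [g] on [FS] and 0 on [genRG] agree on the
    intersection, they glue to a homomorphism on [FS + genRG], which extends to F_G. The extension
    kills the relators, so on pairs it is a symmetric cocycle, hence a coboundary, and on [S] it is
    still [g]. *)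
Lemma coboundary_of_trivial_restriction (g : {additive FG -> Fx}) :
    (forall x, x \in genRG -> x \in FS -> g x = 0) ->
  exists alpha, forall p : S, g << val p >> = cobound alpha (val p).
Proof.
move=> g0; have divF := @closed_units_divisible F.
(* The graph of the glued map: [y] is the [FS] component of [p.1]. *)
pose Gam : set (FG * Fx) :=
  [set p | exists y, [/\ y \in FS, p.1 - y \in genRG & p.2 = g y]].
have [|h hP] := @partial_hom_total FG Fx Gam divF.
  split; first split.
  - by exists 0; rewrite /= subr0 raddf0; split=> //; exact: rpred0.
  - move=> [x a] [x' a'] [y /= [yS xy ->]] [y' /= [yS' xy' ->]].
    exists (y - y'); split=> /=; rewrite ?raddfB //; first exact: rpredB.
    by have := rpredB xy xy'; rewrite opprD opprK addrACA -[y']opprK -opprD.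
  by move=> a [y /= [yS + ->]]; rewrite sub0r rpredN => /g0 ->.
have hR x : x \in genRG -> h x = 0.
  move=> Rx; apply/esym/hP; exists 0; rewrite /= subr0 raddf0.
  by split=> //; exact: rpred0.
have [||alpha aE] := @symmetric_cocycle_coboundary G Fx
    (fun x y => h << mkupair x y >>) divF.
- move=> x y; congr (h << _ >>); apply/eqmodP.
  by rewrite /= /swap_eq eqxx orbT.
- move=> x y z; apply/subr0_eq.
  rewrite -!raddfD -raddfB; apply/hR/mem_generated; exists x, y, z.
  by rewrite /relator opprD addrA.
exists alpha => p; rewrite [val p]upair_mk coboundE -aE -upair_mk.
by apply: hP; exists << val p >>; rewrite subrr rpred0 gen_in_FS.
Qed.

(** Coboundaries are cocycles: on a relator, the terms in [g + h] and in [h + k] telescope and the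
    rest cancels. *)
Lemma coboundary_vanishes_genRG alpha : exists2 L : {additive FG -> Fx},
  forall p, L << p >> = cobound alpha p & forall x, x \in genRG -> L x = 0.
Proof.
have [L LE] := freeg_lift (@cobound G F alpha).
exists L => // x; apply: additive_generated0 => _ [g [h [k ->]]].
rewrite /relator !raddfB raddfD !LE !coboundE [g + (h + k)]addrA.
set a := alpha g; set b := alpha h; set c := alpha k.
set d := alpha (g + h); set e := alpha (h + k); set f := alpha (g + h + k).
rewrite -[LHS]addrA -opprD -[d + c - f]addrA [a + b - d + _]addrA subrK.
rewrite [a + e]addrC -[e + a - f]addrA [b + c - e + _]addrA subrK.
by rewrite [a + b + _](AC (2*2) ((2*3)*(1*4))) subrr.
Qed.

End Restriction.

(** * Kernel and surjectivity of the restriction map *)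

Theorem corollary21 (G : zmodType) (S : set (upair G)) (F : closedFieldType) :
  exists f : {additive H2 S F -> AddHom (KS S) (units_type F)}, bijective f.
Proof.
have divF := @closed_units_divisible F.
have [r rE] := res_KS S F.
apply: (@ideal_quot_iso _ _ _ r) => [chi|psi].
  rewrite mem_preimage_pred; apply/asboolP/eqP => [[alpha chiE]|r0].
    (* A lift [g] of [chi] to F_G agrees with [L] on [S], hence on [FS], and [L] vanishes on
       [genRG]. *)
    have [L LE L0] := coboundary_vanishes_genRG alpha.
    have [g gE] := subquotient_extend chi divF.
    apply/val_inj/funext => z; have [x ->] := subquotient_class_surj z.
    rewrite rE gE /= (@freeg_eq_on_FS _ S _ g L) ?capz_FS // => [|p].
      by apply: L0; have := valP x; rewrite mem_capz => /andP[].
    have <- : Hom_Fun chi p = L << val p >> by rewrite chiE LE.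
    by rewrite /Hom_Fun gE.
  have [g gE] := subquotient_extend chi divF.
  have [|alpha aE] := @coboundary_of_trivial_restriction _ S _ g.
    move=> x xR xS.
    have xC : x \in capz (generated (@RG G)) (@FS G S) by rewrite mem_capz xR.
    by have := rE chi (Subgroup xC); rewrite r0 gE /= => <-.
  by exists alpha; apply/funext => p; rewrite -aE -[LHS]/(Hom_Fun chi p) /Hom_Fun gE.
(* Surjectivity: extend [psi] to F_G; the extension kills [generated (RS S)], whose elements have
   class 0 in [KS], so it descends to [ZS]. *)
have [g gE] := subquotient_extend psi divF.
have [|chi chiE] := @subquotient_restrict _ _ (@FS G S) (generated (RS S)) g.
  move=> x xB; rewrite -[x]/(val (Subgroup (genRS_sub xB))) -gE.
  have /eqP -> : subquotient_class (generated (RS S)) (Subgroup (genRS_sub xB)) == 0.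
    by rewrite subquotient_class_eq0.
  by rewrite -[X in val psi X](subrr 0) AddHom_additive subrr.
exists chi; apply/val_inj/funext => z; have [x ->] := subquotient_class_surj z.
by rewrite rE chiE gE.
Qed.
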